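(* Let $\mathcal{T} \subseteq K^*_{++}$. Then the penalty function $\Phi_{\tau}$ is globally exact if and only if the following two conditions hold true: (1) $\Phi_{\tau}$ is locally exact at every globally optimal solution of the problem $(\mathcal{P})$; (2) the Simplest Global Exact Penalty Method (described in the context) with arbitrary $\tau_1 \in \mathcal{T}$ terminates after a finite number of iterations.
   Context: Setting. $(X,d)$ is a metric space, $M, Q \subseteq X$ satisfy $M \cap Q \neq \emptyset$, and $f \colon X \to \mathbb{R} \cup \{+\infty\}$. Problem $(\mathcal{P})$: minimize $f(x)$ subject to $x \in M \cap Q$. It is assumed throughout that $(\mathcal{P})$ has a globally optimal solution and that its optimal value is finite. $Y$ is a real normed space, $K \subset Y$ is a closed convex pointed cone ($K \cap (-K) = \{0\}$). An improper element $\infty$ is added to $Y$, with $\|\infty\| = +\infty$. $\varphi \colon X \to K \cup \{\infty\}$ is a function such that $\varphi(x) = 0$ iff $x \in M$. $Y^*$ is the topological dual of $Y$, $\langle\cdot,\cdot\rangle$ is the duality pairing, $K^* = \{y^* \in Y^* : \langle y^*, y\rangle \ge 0 \ \forall y \in K\}$, and $K^*_+ = \{y^* \in K^* : \langle y^*, y \rangle > 0 \ \forall y \in K \setminus \{0\}\}$, assumed nonempty. $K^*_{++}$ is the set of all $\tau \in K^*_+$ for which there exists $c>0$ with $\langle \tau, y\rangle \ge c\|y\|$ for all $y \in K$. $\mathcal{T} \subset K^*_+$ is a fixed nonempty set with $\alpha\tau \in \mathcal{T}$ for all $\tau \in \mathcal{T}$, $\alpha>0$. For $\tau \in \mathcal{T}$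 and $x \in X$, $\Phi_\tau(x) = f(x) + \langle \tau, \varphi(x)\rangle$, where $\langle \tau, \infty\rangle = +\infty$. Problem $(\mathcal{P}_\tau)$: minimize $\Phi_\tau(x)$ subject to $x \in Q$. Write $\tau \succeq_{K^*} \tau_*$ iff $\tau - \tau_* \in K^*$. Local exactness. If $x_*$ is a locally optimal solution of $(\mathcal{P})$, $\Phi_\tau$ is called locally exact at $x_*$ if there is $\tau_* \in \mathcal{T}$ such that for all $\tau \in \mathcal{T}$ with $\tau \succeq_{K^*} \tau_*$ the point $x_*$ is a locally optimal solution of $(\mathcal{P}_\tau)$. Global exactness. $\Phi_\tau$ is called globally exact if there is $\tau_* \in \mathcal{T}$ such that for all $\tau \in \mathcal{T}$ with $\tau \succeq_{K^*} \tau_*$ the set of globally optimal solutions of $(\mathcal{P})$ coincides with the set of globally optimal solutions of $(\mathcal{P}_\tau)$. Simplest Global Exact Penalty Method. Choose $\tau_1 \in \mathcal{T}$ and $\theta > 1$, and set $n := 1$. Main step: set $x_n$ to a globally optimal solution of $(\mathcal{P}_{\tau_n})$. If $n \ge 2$ and $\Phi_{\tau_n}(x_n) = \Phi_{\tau_{n-1}}(x_{n-1})$, stop. Otherwise put $\tau_{n+1} = \theta \tau_n$, $n := n+1$, and repeat the main step.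
   Formalization: It is additionally assumed that for every τ in T the penalized problem (P_τ) has a globally optimal solution, so that the method can be carried out from any τ_1; without this the equivalence fails (e.g. f = -|x| or f = -x² on the real line with M = {0}, φ = |x|). *)

(* Defs.v *)
From mathcomp Require Import all_boot all_order all_algebra.
From mathcomp Require Import all_classical all_reals all_analysis.

Set Implicit Arguments.
Unset Strict Implicit.
Unset Printing Implicit Defensive.

Import Order.TTheory GRing.Theory Num.Theory.
Import numFieldNormedType.Exports.

Local Open Scope classical_set_scope.
Local Open Scope ring_scope.

Definition global_solutions (R : realType) (X : Type) (A : set X)
    (g : X -> \bar R) : set X :=
  [set x | A x /\ forall y, A y -> (g x <= g y)%E].

Definition local_solutions (R : realType) (X : metricType R) (A : set X)
    (g : X -> \bar R) : set X :=
  [set x | A x /\ \forall y \near x, A y -> (g x <= g y)%E].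

Definition closed_convex_pointed_cone (R : realType) (Y : normedModType R)
    (K : set Y) : Prop :=
  [/\ closed K,
      convex_set (K : set (convex_lmodType Y)),
      (forall (a : R) (y : Y), 0 <= a -> K y -> K (a *: y)) &
      K `&` (-%R @` K) = [set 0]].

(* The topological dual is a set of functions; sums and multiples of
   functionals are the pointwise ones of the function space [Y -> R^o]. *)
Definition dual (R : realType) (Y : normedModType R) : set (Y -> R^o) :=
  [set u | linear u /\ continuous u].

Definition dual_cone (R : realType) (Y : normedModType R) (K : set Y) :
    set (Y -> R^o) :=
  [set u | dual u /\ forall y, K y -> 0 <= u y].

Definition dual_cone_pos (R : realType) (Y : normedModType R) (K : set Y) :
    set (Y -> R^o) :=
  [set u | dual_cone K u /\ forall y, K y -> y <> 0 -> 0 < u y].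

Definition dual_cone_coercive (R : realType) (Y : normedModType R)
    (K : set Y) : set (Y -> R^o) :=
  [set u | dual_cone_pos K u /\
     exists2 c : R, 0 < c & forall y, K y -> c * `|y| <= u y].

Definition dual_ge (R : realType) (Y : normedModType R) (K : set Y)
    (u v : Y -> R^o) : Prop := dual_cone K (u - v).

(* [None] is the improper element adjoined to Y. *)
Definition pairing (R : realType) (Y : normedModType R) (u : Y -> R^o)
    (z : option Y) : \bar R :=
  if z is Some y then (u y)%:E else +oo%E.

Definition penalty (R : realType) (X : metricType R) (Y : normedModType R)
    (f : X -> \bar R) (phi : X -> option Y) (tau : Y -> R^o) : X -> \bar R :=
  fun x => (f x + pairing tau (phi x))%E.

Definition locally_exact (R : realType) (X : metricType R)
    (Y : normedModType R) (K : set Y) (T : set (Y -> R^o)) (Q : set X)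
    (f : X -> \bar R) (phi : X -> option Y) (x : X) : Prop :=
  exists2 tau0, T tau0 &
    forall tau, T tau -> dual_ge K tau tau0 ->
      local_solutions Q (penalty f phi tau) x.

Definition globally_exact (R : realType) (X : metricType R)
    (Y : normedModType R) (K : set Y) (T : set (Y -> R^o)) (M Q : set X)
    (f : X -> \bar R) (phi : X -> option Y) : Prop :=
  exists2 tau0, T tau0 &
    forall tau, T tau -> dual_ge K tau tau0 ->
      global_solutions (M `&` Q) f = global_solutions Q (penalty f phi tau).

(* The iterations of the method are numbered from 0: [method_param theta tau1 n]
   and [x n] below are the penalty parameter and the iterate of the (n+1)-st
   main step. *)
Definition method_param (R : realType) (Y : normedModType R) (theta : R)
    (tau1 : Y -> R^o) (n : nat) : Y -> R^o :=
  iter n (fun tau => theta *: tau) tau1.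

Definition method_stops_at (R : realType) (X : metricType R)
    (Y : normedModType R) (f : X -> \bar R) (phi : X -> option Y) (theta : R)
    (tau1 : Y -> R^o) (x : nat -> X) (n : nat) : Prop :=
  (0 < n)%N /\
  penalty f phi (method_param theta tau1 n) (x n) =
  penalty f phi (method_param theta tau1 n.-1) (x n.-1).

(* The main step is constrained only as long as the stopping criterion has not
   been met; the values of [x] after that are irrelevant. *)
Definition method_run (R : realType) (X : metricType R)
    (Y : normedModType R) (Q : set X) (f : X -> \bar R)
    (phi : X -> option Y) (theta : R) (tau1 : Y -> R^o) (x : nat -> X) : Prop :=
  forall n : nat,
    (forall k, (k < n)%N -> ~ method_stops_at f phi theta tau1 x k) ->
    global_solutions Q (penalty f phi (method_param theta tau1 n)) (x n).

Definition method_terminates (R : realType) (X : metricType R)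
    (Y : normedModType R) (Q : set X) (f : X -> \bar R)
    (phi : X -> option Y) (tau1 : Y -> R^o) : Prop :=
  forall (theta : R) (x : nat -> X), 1 < theta ->
    method_run Q f phi theta tau1 x ->
    exists n, method_stops_at f phi theta tau1 x n.

(* Main.v *)
Require Import Defs.
From HB Require Import structures.
From mathcomp Require Import all_boot all_order all_algebra.
From mathcomp Require Import all_classical all_reals all_analysis.
From mathcomp Require Import lra.

Import Order.TTheory GRing.Theory Num.Theory.
Import numFieldNormedType.Exports.

Local Open Scope classical_set_scope.
Local Open Scope ring_scope.

(** The hinge is the following certificate: if the minimum of [penalty f phi
    tau] over [Q] equals the optimal value of the constrained problem, then
    every parameter dominating [a *: tau], for some [a > 1], is exact.  Indeed
    the penalty functions increase with the parameter, so their minima stay at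
    the optimal value and the constrained solutions remain minimizers; and they
    increase strictly at every point of finite value where [phi] does not
    vanish, so no infeasible point can be a minimizer
    ([exact_beyond_optimal_value]).

    The stopping test of the method produces such a certificate.  If the minima
    for [tau] and [a *: tau] agree, the minimizer for [a *: tau] cannot be
    infeasible, because its value for [tau] would then be strictly below the
    minimum for [tau] ([equal_minima_feasible]).  A terminating run, which
    exists because the penalty problems are solvable, hence gives global
    exactness.

    Conversely, the exactness threshold [tau0] is a bounded functional while
    [tau1] is coercive on the cone, so the geometric sequence of parameters
    eventually dominates [tau0] ([coercive_geometric_dominates]).  From then on
    every iterate solves the constrained problem, the minimal penalty value
    is constant, and the method stops. *)

(** * Functionals on the cone *)

Lemma dual_bounded (R : realType) (Y : normedModType R) (u : Y -> R^o) :
  dual u -> exists C : R, forall y, u y <= C * `|y|.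
Proof.
move=> [ulin ucont].
pose L : {linear Y -> R^o} :=
  HB.pack u (GRing.isLinear.Build R Y R^o *:%R u ulin).
have /linear_boundedP := (linear_bounded_continuous L).2 ucont.
move=> /pinfty_ex_gt0[C _ HC]; exists C => y.
exact: le_trans (ler_norm _) (HC y).
Qed.

Lemma dualB (R : realType) (Y : normedModType R) (u v : Y -> R^o) :
  dual u -> dual v -> dual (u - v).
Proof.
move=> [ulin ucont] [vlin vcont]; split.
  by move=> a x y; rewrite !fctE ulin vlin scalerBr opprD addrACA.
by move=> y; apply: (@cvgB _ R^o); [exact: ucont|exact: vcont].
Qed.

Lemma dual_geP (R : realType) (Y : normedModType R) (K : set Y)
    (u v : Y -> R^o) :
  dual u -> dual v -> (forall y, K y -> v y <= u y) -> dual_ge K u v.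
Proof.
move=> du dv vu; split; first exact: dualB.
by move=> y Ky; rewrite fctE subr_ge0 vu.
Qed.

Lemma dual_ge_le (R : realType) (Y : normedModType R) (K : set Y)
    (u v : Y -> R^o) y : dual_ge K u v -> K y -> v y <= u y.
Proof. by move=> [_ uv] Ky; rewrite -subr_ge0; exact: uv. Qed.

Lemma method_paramE (R : realType) (Y : normedModType R) (theta : R)
    (tau : Y -> R^o) n : method_param theta tau n = theta ^+ n *: tau.
Proof.
elim: n => [|n IHn]; first by rewrite expr0 scale1r.
by rewrite exprS -scalerA -IHn.
Qed.

(** By Bernoulli's inequality the powers grow at least linearly, and the reals
    are archimedean. *)
Lemma geometric_unbounded (R : realType) (theta B : R) :
  1 < theta -> exists N, forall n, (N <= n)%N -> B <= theta ^+ n.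
Proof.
move=> th1; have th0 : 0 < theta - 1 by rewrite subr_gt0.
have bernoulli n : n%:R * (theta - 1) <= theta ^+ n.
  elim: n => [|n IHn]; first by rewrite mul0r expr0.
  have : 1 <= theta ^+ n by rewrite exprn_ege1 ?ltW.
  rewrite exprS -natr1; nra.
exists (Num.bound (`|B| / (theta - 1))) => n Nn.
apply: le_trans (bernoulli n); rewrite -ler_pdivrMr//.
apply: le_trans (_ : `|B| / (theta - 1) <= _).
  by rewrite ler_pM2r ?invr_gt0// ler_norm.
apply: le_trans (_ : (Num.bound (`|B| / (theta - 1)))%:R <= _).
  by rewrite ltW// archi_boundP// divr_ge0// ltW.
by rewrite ler_nat.
Qed.

(** Coercivity of [u] and boundedness of [v] compare both functionals with
    the norm: [v y <= C * |y|] and [c * |y| <= u y] on [K], so any factor from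
    [C / c] on is enough. *)
Lemma coercive_geometric_dominates (R : realType) (Y : normedModType R)
    (K : set Y) (u v : Y -> R^o) (theta : R) :
  dual_cone_coercive K u -> dual v -> 1 < theta ->
  exists N, forall n y, (N <= n)%N -> K y -> v y <= (theta ^+ n *: u) y.
Proof.
move=> [_ [c c0 cu]] /dual_bounded[C vC] th1.
have [N HN] := @geometric_unbounded R theta (C / c) th1.
exists N => n y Nn Ky; apply: le_trans (vC y) _.
have ? : C <= theta ^+ n * c by rewrite -ler_pdivrMr// HN.
apply: le_trans (_ : theta ^+ n * (c * `|y|) <= _).
  by rewrite mulrA ler_wpM2r.
rewrite fctE /GRing.scale/= ler_wpM2l ?cu// exprn_ge0//.
by apply: le_trans (ltW th1).
Qed.

(** * Penalty functions and their minima *)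

Lemma penalty_feasible (R : realType) (X : metricType R) (Y : normedModType R)
    (f : X -> \bar R) (phi : X -> option Y) (tau : Y -> R^o) x :
  dual tau -> phi x = Some 0 -> penalty f phi tau x = f x.
Proof.
move=> [taulin _] phix; rewrite /penalty phix /=.
(* linearity in the form [tau (1 *: 0 + 0) = 1 *: tau 0 + tau 0] *)
have := taulin 1 0 0; rewrite !scale1r addr0 => tau00.
by rewrite (_ : tau 0 = 0) ?adde0//; apply: (addrI (tau 0)); rewrite addr0.
Qed.

Lemma le_penalty (R : realType) (X : metricType R) (Y : normedModType R)
    (f : X -> \bar R) (K : set Y) (phi : X -> option Y) (tau tau' : Y -> R^o)
    x :
  (forall x y, phi x = Some y -> K y) -> dual_ge K tau' tau ->
  (penalty f phi tau x <= penalty f phi tau' x)%E.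
Proof.
move=> phiK tt'; rewrite /penalty; apply: leeD2l.
case E: (phi x) => [y|] //=; rewrite lee_fin.
by apply: dual_ge_le tt' _; exact: phiK E.
Qed.

Lemma lt_penalty_infeasible (R : realType) (X : metricType R)
    (Y : normedModType R) (f : X -> \bar R) (K : set Y) (phi : X -> option Y)
    (tau : Y -> R^o) (a : R) x :
  (forall x, f x <> -oo%E) -> (forall x y, phi x = Some y -> K y) ->
  dual_cone_pos K tau -> 1 < a -> phi x <> Some 0 ->
  (penalty f phi tau x < +oo)%E ->
  (penalty f phi tau x < penalty f phi (a *: tau) x)%E.
Proof.
move=> fNoo phiK [_ taupos] a1 phix; rewrite /penalty.
have := fNoo x; case: (f x) => [r| |] // _; case E: (phi x) => [y|] //= _.
rewrite lte_fin ltrD2l fctE /GRing.scale/= ltr_pMl//.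
apply: taupos; first exact: phiK E.
by move=> y0; apply: phix; rewrite E y0.
Qed.

Lemma global_solutions_eq_value (R : realType) (X : Type) (A : set X)
    (g : X -> \bar R) x y :
  global_solutions A g x -> global_solutions A g y -> g x = g y.
Proof.
by move=> [Ax gx] [Ay gy]; apply/eqP; rewrite eq_le gx// gy.
Qed.

(** [x0] only provides a finite upper bound for the minimum: at an infeasible
    [x'] the value for [tau] would be strictly smaller than the value for
    [a *: tau], which is the minimum for [tau]. *)
Lemma equal_minima_feasible (R : realType) (X : metricType R)
    (Y : normedModType R) (Q : set X) (f : X -> \bar R) (K : set Y)
    (phi : X -> option Y) (tau : Y -> R^o) (a : R) x0 x x' :
  (forall x, f x <> -oo%E) -> (forall x y, phi x = Some y -> K y) ->
  dual_cone_pos K tau -> 1 < a ->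
  Q x0 -> (penalty f phi tau x0 < +oo)%E ->
  global_solutions Q (penalty f phi tau) x ->
  global_solutions Q (penalty f phi (a *: tau)) x' ->
  penalty f phi (a *: tau) x' = penalty f phi tau x ->
  phi x' = Some 0.
Proof.
move=> fNoo phiK taupos a1 Qx0 x0fin [Qx xmin] [Qx' _] eqv.
apply: contrapT => infeas.
have [x'fin|] := ltP (penalty f phi tau x') +oo%E; last first.
  rewrite leye_eq => /eqP x'oo.
  have : (penalty f phi tau x < +oo)%E by exact: le_lt_trans (xmin _ Qx0) x0fin.
  rewrite -eqv; move: x'oo; rewrite /penalty.
  by have := fNoo x'; case: (f x') => [r| |] // _; case: (phi x').
have := @lt_penalty_infeasible _ _ _ f K phi tau a x'
  fNoo phiK taupos a1 infeas x'fin.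
by rewrite eqv ltNge xmin.
Qed.

(** The factor [a > 1] is what separates the solution sets: for [tau] itself an
    infeasible point may still attain the optimal value. *)
Lemma exact_beyond_optimal_value (R : realType) (X : metricType R)
    (Y : normedModType R) (M Q : set X) (f : X -> \bar R) (K : set Y)
    (phi : X -> option Y) (tau tau' : Y -> R^o) (a : R) x0 :
  (forall x, f x <> -oo%E) -> (forall x y, phi x = Some y -> K y) ->
  (forall x, phi x = Some 0 <-> M x) ->
  dual_cone_pos K tau -> dual tau' -> 1 < a -> dual_ge K tau' (a *: tau) ->
  global_solutions (M `&` Q) f x0 -> (f x0 < +oo)%E ->
  (forall x, Q x -> (f x0 <= penalty f phi tau x)%E) ->
  global_solutions (M `&` Q) f = global_solutions Q (penalty f phi tau').
Proof.
move=> fNoo phiK phiM taupos dtau' a1 tautau' [[Mx0 Qx0] x0min] x0fin opt.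
have feas x : M x -> penalty f phi tau' x = f x.
  by move=> /phiM; exact: penalty_feasible.
have penle x : (penalty f phi tau x <= penalty f phi tau' x)%E.
  apply: (le_trans _ (@le_penalty _ _ _ f K phi _ _ x phiK tautau')).
  rewrite /penalty; apply: leeD2l; case E: (phi x) => [y|] //=.
  rewrite lee_fin fctE /GRing.scale/= ler_peMl //; last exact: ltW.
  by apply: taupos.1.2; exact: phiK E.
apply/seteqP; split=> x.
  move=> [[Mx Qx] xmin]; split=> // y Qy; rewrite feas//.
  apply: le_trans (penle y); apply: le_trans (opt y Qy).
  by apply: xmin; split.
move=> [Qx xmin].
have xle : (penalty f phi tau' x <= f x0)%E by rewrite -(feas x0 Mx0) xmin.
have Mx : M x.
  apply/phiM; apply: contrapT => infeas.
  have xfin : (penalty f phi tau x < +oo)%E.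
    exact: le_lt_trans (le_trans (penle x) xle) x0fin.
  have := @lt_penalty_infeasible _ _ _ f K phi tau a x
    fNoo phiK taupos a1 infeas xfin.
  rewrite ltNge => /negP; apply.
  apply: le_trans (opt x Qx); apply: le_trans xle.
  exact: le_penalty phiK tautau'.
split=> // y yMQ; rewrite -(feas x Mx).
exact: le_trans xle (x0min y yMQ).
Qed.

(** * Termination of the method *)

(** As long as no stop occurs the iterates are minimizers; two consecutive ones
    beyond the exactness threshold are both solutions of the constrained
    problem, where the penalty vanishes. *)
Lemma exact_method_terminates (R : realType) (X : metricType R)
    (Y : normedModType R) (M Q : set X) (f : X -> \bar R) (K : set Y)
    (phi : X -> option Y) (T : set (Y -> R^o)) (tau1 : Y -> R^o) :
  (forall x, phi x = Some 0 <-> M x) -> T `<=` dual_cone_coercive K ->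
  (forall (tau : Y -> R^o) (a : R), T tau -> 0 < a -> T (a *: tau)) ->
  globally_exact K T M Q f phi -> T tau1 -> method_terminates Q f phi tau1.
Proof.
move=> phiM Tco Tscale [tau0 Ttau0 exact0] Ttau1 theta x th1 run.
apply: contrapT => nostop.
have Tdual tau : T tau -> dual tau by move=> /Tco[[[]]].
have [N HN] := @coercive_geometric_dominates _ _ _ _ _ _
  (Tco _ Ttau1) (Tdual _ Ttau0) th1.
have Tn n : T (theta ^+ n *: tau1).
  by apply: Tscale; rewrite ?exprn_gt0// (lt_trans ltr01).
have ge0 n : (N <= n)%N -> dual_ge K (theta ^+ n *: tau1) tau0.
  move=> Nn; apply: dual_geP; [exact: Tdual|exact: Tdual|].
  by move=> y; exact: HN.
have sol n : (N <= n)%N -> global_solutions (M `&` Q) f (x n).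
  move=> Nn; rewrite (exact0 _ (Tn n) (ge0 n Nn)) -method_paramE.
  by apply: run => k _ stop; apply: nostop; exists k.
have val n : (N <= n)%N ->
    penalty f phi (method_param theta tau1 n) (x n) = f (x n).
  move=> Nn; rewrite method_paramE; apply: penalty_feasible; first exact: Tdual.
  by apply/phiM; exact: (sol n Nn).1.1.
apply: nostop; exists N.+1; split=> //; rewrite (val N) ?val//.
by apply: (@global_solutions_eq_value _ _ (M `&` Q)); exact: sol.
Qed.

(** At the first stop the last iterate is feasible, so the current minimal
    penalty value is the optimal value; one more multiplication by the growth
    factor yields the exactness threshold. *)
Lemma terminates_globally_exact (R : realType) (X : metricType R)
    (Y : normedModType R) (M Q : set X) (f : X -> \bar R) (K : set Y)
    (phi : X -> option Y) (T : set (Y -> R^o)) (tau1 : Y -> R^o) x0 :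
  (forall x, f x <> -oo%E) -> (forall x y, phi x = Some y -> K y) ->
  (forall x, phi x = Some 0 <-> M x) -> T `<=` dual_cone_pos K ->
  (forall (tau : Y -> R^o) (a : R), T tau -> 0 < a -> T (a *: tau)) ->
  (forall tau, T tau -> global_solutions Q (penalty f phi tau) !=set0) ->
  global_solutions (M `&` Q) f x0 -> (f x0 < +oo)%E ->
  T tau1 -> method_terminates Q f phi tau1 -> globally_exact K T M Q f phi.
Proof.
move=> fNoo phiK phiM Tpos Tscale Tsol solx0 x0fin Ttau1 term.
have two1 : 1 < 2 :> R by rewrite ltr1n.
have Tn n : T (method_param 2 tau1 n).
  by rewrite method_paramE; apply: Tscale; rewrite ?exprn_gt0.
have /choice[x xsol] : forall n, exists x,
    global_solutions Q (penalty f phi (method_param 2 tau1 n)) x.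
  by move=> n; exact: Tsol.
have [[|n] [// _ /= stop]] := term 2 x two1 (fun n _ => xsol n).
set tau := method_param 2 tau1 n in stop.
have [[Mx0 Qx0] x0min] := solx0.
have feas tau' y : T tau' -> M y -> penalty f phi tau' y = f y.
  by move=> /Tpos[[dtau' _] _] /phiM; exact: penalty_feasible.
have phixS : phi (x n.+1) = Some 0.
  apply: (@equal_minima_feasible _ _ _ Q f K phi tau 2 x0 (x n) (x n.+1)
    fNoo phiK (Tpos _ (Tn n)) two1 Qx0 _ (xsol n) (xsol n.+1) stop).
  by rewrite feas//; exact: Tn.
exists (2 *: method_param 2 tau1 n.+1); first by apply: Tscale; [exact: Tn|].
move=> tau' Ttau' ge'.
apply: (@exact_beyond_optimal_value _ _ _ M Q f K phi
  (method_param 2 tau1 n.+1) tau' 2 x0) => //.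
- exact: Tpos (Tn n.+1).
- by have [[]] := Tpos _ Ttau'.
move=> y Qy; have [QxS xSmin] := xsol n.+1.
apply: le_trans (xSmin y Qy); rewrite feas; [|exact: Tn|exact/phiM].
by apply: x0min; split=> //; exact/phiM.
Qed.

Theorem theorem3 (R : realType) (X : metricType R) (Y : normedModType R)
    (M Q : set X) (f : X -> \bar R)
    (K : set Y) (phi : X -> option Y) (T : set (Y -> R^o))
    (hMQ : M `&` Q !=set0)
    (hf : forall x, f x <> -oo%E)
    (hsol : global_solutions (M `&` Q) f !=set0)
    (hfin : ereal_inf [set f x | x in M `&` Q] \is a fin_num)
    (hK : closed_convex_pointed_cone K)
    (hphiK : forall x y, phi x = Some y -> K y)
    (hphiM : forall x, phi x = Some 0 <-> M x)
    (hKpos : dual_cone_pos K !=set0)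
    (hT0 : T !=set0)
    (hTpos : T `<=` dual_cone_pos K)
    (hTscale : forall (tau : Y -> R^o) (a : R), T tau -> 0 < a -> T (a *: tau))
    (* the main step of the method is well defined for every parameter in T *)
    (hsolT : forall tau, T tau -> global_solutions Q (penalty f phi tau) !=set0)
    (hT : T `<=` dual_cone_coercive K) :
  globally_exact K T M Q f phi <->
  (forall x, global_solutions (M `&` Q) f x -> locally_exact K T Q f phi x) /\
  (forall tau1, T tau1 -> method_terminates Q f phi tau1).
Proof.
split=> [exactT|[_ term]].
  split=> [x solx|tau1]; last exact: exact_method_terminates hphiM hT hTscale _.
  have [tau0 Ttau0 exact0] := exactT; exists tau0 => // tau Ttau ge0.
  move: solx; rewrite (exact0 tau Ttau ge0) => -[Qx xmin].
  by split=> //; exact: nearW.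
have [x0 solx0] := hsol; have [tau1 Ttau1] := hT0.
apply: (@terminates_globally_exact _ _ _ M Q f K phi T tau1 x0) => //.
  have [_ x0min] := solx0.
  (* the infimum dominates the attained value [f x0] *)
  apply: (@le_lt_trans _ _ (ereal_inf [set f x | x in M `&` Q])).
    by apply: le_ereal_inf_tmp => _ [y yMQ <-]; exact: x0min.
  by rewrite ltey_eq; apply/orP; left.
exact: term.
Qed.
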